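(* Let $A\in\mathbb{C}^{q\times n}$, let $W\in\mathbb{C}^{n\times q}$ be nonzero, and let $m$ be a positive integer. Then the system of matrix equations $$X=WA^{D,W}WAX,\qquad AX=AWA^{\mathrm{wg}_m,W}WAA^{\dag}$$ in the unknown $X\in\mathbb{C}^{n\times q}$ has the unique solution $X=WA^{\mathrm{wg}_m,W}WAA^{\dag}$.
   Context: $M^{\dag}$ is the Moore-Penrose inverse of a complex matrix $M$, and $\mathcal{R}(M)$ its range. For square $M$: $M^0=I$, $\mathrm{Ind}(M)$ is the smallest nonnegative integer $k$ with $\mathrm{rank}(M^k)=\mathrm{rank}(M^{k+1})$; $M^D$ is the Drazin inverse; the core-EP inverse $M^{\mathrm{cEP}}$ is the unique $X$ with $XMX=X$ and $\mathcal{R}(X)=\mathcal{R}(X^* )=\mathcal{R}(M^{\mathrm{Ind}(M)})$. For $X,Y\in\mathbb{C}^{q\times n}$ the $W$-product is $X\star Y=XWY$, and $X^{\star l}$ is the $l$-fold $W$-product of $X$ with itself. The $W$-weighted Drazin inverse is $A^{D,W}=A((WA)^D)^2$; the weighted core-EP inverse is $A^{\mathrm{cEP},W}=A((WA)^{\mathrm{cEP}})^2$; the $W$-weighted $m$-weak group inverse is $A^{\mathrm{wg}_m,W}=(A^{\mathrm{cEP},W})^{\star(m+1)}WA^{\star m}\in\mathbb{C}^{q\times n}$. *)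

(* Defs.v *)
From mathcomp Require Import all_boot all_order all_algebra.
Set Implicit Arguments.
Unset Strict Implicit.
Unset Printing Implicit Defensive.
Import Order.TTheory GRing.Theory Num.Theory.
Local Open Scope ring_scope.
Local Open Scope sesquilinear_scope.

(* The range of M is its column space; the comparison is delegated to the row
   spaces of the transposes, and [eq_rangeP] gives the pointwise meaning. *)
Definition eq_range (F : fieldType) m n p (M : 'M[F]_(m, n)) (N : 'M[F]_(m, p))
  : bool := (M^T == N^T)%MS.

Lemma range_subP (F : fieldType) m n p (M : 'M[F]_(m, n)) (N : 'M[F]_(m, p)) :
  reflect (exists Z, M = N *m Z) (M^T <= N^T)%MS.
Proof.
apply: (iffP submxP) => [[Z E]|[Z ->]]; exists Z^T; last by rewrite trmx_mul.
by apply: trmx_inj; rewrite E trmx_mul trmxK.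
Qed.

Lemma eq_rangeP (F : fieldType) m n p (M : 'M[F]_(m, n)) (N : 'M[F]_(m, p)) :
  reflect (forall y : 'cV[F]_m,
             (exists x, y = M *m x) <-> (exists x, y = N *m x))
          (eq_range M N).
Proof.
apply: (iffP idP) => [/andP[/range_subP[Z EM] /range_subP[T EN]] y|H].
  by split=> -[x ->]; [exists (Z *m x); rewrite EM | exists (T *m x); rewrite EN];
    rewrite mulmxA.
apply/andP; split; apply/row_subP => j; rewrite -tr_col colE; apply/range_subP.
  by apply/H; exists (delta_mx j 0).
by apply/H; exists (delta_mx j 0).
Qed.

Lemma eq_range_sym (F : fieldType) m n p (M : 'M[F]_(m, n)) (N : 'M[F]_(m, p)) :
  eq_range M N = eq_range N M.
Proof. exact: andbC. Qed.

Lemma eq_range_trans (F : fieldType) m n p r (N : 'M[F]_(m, p))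
  (M : 'M[F]_(m, n)) (K : 'M[F]_(m, r)) :
  eq_range M N -> eq_range N K -> eq_range M K.
Proof. by move=> /eqmxP h /eqmxP g; apply/eqmxP; exact: eqmx_trans h g. Qed.

Section Index.
Variables (F : fieldType) (n : nat).
Implicit Types M : 'M[F]_n.

Lemma rank_exprS M k : (\rank (M ^+ k.+1) <= \rank (M ^+ k))%N.
Proof. by rewrite exprS; exact: mxrankM_maxr. Qed.

Lemma mxindex_ex M : exists k, \rank (M ^+ k) == \rank (M ^+ k.+1).
Proof.
suff H b : forall k, (\rank (M ^+ k) <= b)%N ->
    exists k, \rank (M ^+ k) == \rank (M ^+ k.+1) by exact: (H _ 0%N (leqnn _)).
elim: b => [|b IH] k hk.
  exists k; rewrite eqn_leq rank_exprS andbT.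
  by rewrite (leq_trans hk).
have := rank_exprS M k; rewrite leq_eqVlt => /orP[/eqP E|L].
  by exists k; rewrite E.
by apply: (IH k.+1); rewrite -ltnS (leq_trans L).
Qed.

Definition mxindex M : nat := ex_minn (mxindex_ex M).

End Index.

Lemma mxindexP (F : fieldType) n (M : 'M[F]_n) :
  \rank (M ^+ mxindex M) = \rank (M ^+ (mxindex M).+1) /\
  forall k, \rank (M ^+ k) = \rank (M ^+ k.+1) -> (mxindex M <= k)%N.
Proof. by rewrite /mxindex; case: ex_minnP => k /eqP-> H; split=> // j /eqP/H. Qed.

Section Drazin.
Variables (F : fieldType) (n : nat).
Implicit Types M X Y : 'M[F]_n.

Definition is_drazin M X : bool :=
  [&& X *m M ^+ (mxindex M).+1 == M ^+ mxindex M,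
      X *m M *m X == X & M *m X == X *m M].

Lemma drazin_ex M : exists X, is_drazin M X.
Proof.
have [rk _] := mxindexP M; rewrite /is_drazin; set k := mxindex M in rk *.
have [u Eu] : exists u, M ^+ k = u * M ^+ k.+1.
  apply/submxP.
  have /mxrank_leqif_sup[_ <-] : (M ^+ k.+1 <= M ^+ k)%MS.
    by rewrite exprS; exact: submxMl.
  by rewrite rk.
have [v Ev] : exists v, M ^+ k = M ^+ k.+1 * v.
  apply/range_subP.
  have /mxrank_leqif_sup[_ <-] : ((M ^+ k.+1)^T <= (M ^+ k)^T)%MS.
    by apply/range_subP; exists M; rewrite exprSr.
  by rewrite !mxrank_tr rk.
have uv : u * M ^+ k = M ^+ k * v by rewrite {1}Ev mulrA -Eu.
have uvj j : u ^+ j * M ^+ k = M ^+ k * v ^+ j.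
  elim: j => [|j IH]; first by rewrite !expr0 mul1r mulr1.
  by rewrite exprSr -mulrA uv mulrA IH -mulrA -exprSr.
have uj j : u ^+ j * M ^+ (j + k) = M ^+ k.
  elim: j => [|j IH]; first by rewrite mul1r.
  rewrite exprSr addSn -addnS addnC exprD mulrA -[_ * u * _]mulrA -Eu -mulrA.
  by rewrite -exprD addnC IH.
have vj j : M ^+ (j + k) * v ^+ j = M ^+ k.
  elim: j => [|j IH]; first by rewrite mulr1.
  rewrite exprS addSn -addnS exprD -mulrA [M ^+ k.+1 * _]mulrA -Ev mulrA.
  by rewrite -exprD IH.
exists (u ^+ k.+1 * M ^+ k); apply/and3P; split; apply/eqP.
- by rewrite -[LHS]mulrA -exprD addnC uj.
- have -> : u ^+ k.+1 * M ^+ k *m M = u ^+ k * M ^+ k.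
    by rewrite -[LHS]mulrA -exprSr exprSr -mulrA -Eu.
  rewrite -[LHS]/(_ * _) [u ^+ k.+1 * _]uvj mulrA -[u ^+ k * _ * _]mulrA -exprD.
  by rewrite uj.
- have -> : u ^+ k.+1 * M ^+ k *m M = u ^+ k * M ^+ k.
    by rewrite -[LHS]mulrA -exprSr exprSr -mulrA -Eu.
  rewrite !uvj -[LHS]/(M * (M ^+ k * v ^+ k.+1)) mulrA -exprS.
  by rewrite [v ^+ _]exprS mulrA -Ev.
Qed.

Definition drazin M : 'M[F]_n := xchoose (drazin_ex M).

Lemma drazinP M : is_drazin M (drazin M).
Proof. exact: xchooseP. Qed.

Lemma is_drazin_uniq M X Y : is_drazin M X -> is_drazin M Y -> X = Y.
Proof.
rewrite /is_drazin; set k := mxindex M.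
move=> /and3P[/eqP X1 /eqP X2 /eqP X3] /and3P[/eqP Y1 /eqP Y2 /eqP Y3].
have pw Z j : Z *m M *m Z = Z -> M *m Z = Z *m M ->
    Z = Z ^+ j.+1 * M ^+ j /\ Z = M ^+ j * Z ^+ j.+1.
  move=> Z2 Z3; have c : GRing.comm Z M by apply: esym.
  have E : Z = Z ^+ j.+1 * M ^+ j.
    elim: j => [|j IH]; first by rewrite mulr1.
    by rewrite exprS [M ^+ _]exprSr -mulrA [_ ^+ _ * _]mulrA -IH c mulrA -[LHS]Z2.
  by split=> //; rewrite {1}E; apply/commrX/commr_sym/commrX/commr_sym.
have [EX _] := pw X k X2 X3; have [_ EY] := pw Y k Y2 Y3.
have cY : GRing.comm Y M by apply: esym.
have EkY : M ^+ k = M ^+ k.+1 * Y by rewrite -Y1; exact: (commrX _ cY).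
have EkX : X * M ^+ k.+1 = M ^+ k := X1.
transitivity (X * M * Y).
  have {1}-> : X = X ^+ k.+1 * (M ^+ k.+1 * Y) by rewrite -EkY.
  by rewrite [M ^+ _]exprSr !mulrA -EX.
have {2}-> : Y = X * M ^+ k.+1 * Y ^+ k.+1 by rewrite EkX.
by rewrite exprS -!mulrA -EY.
Qed.

End Drazin.

Section MoorePenrose.
Variable C : numClosedFieldType.

Definition is_mpinv m n (M : 'M[C]_(m, n)) (X : 'M[C]_(n, m)) : bool :=
  [&& M *m X *m M == M, X *m M *m X == X,
      (M *m X)^t* == M *m X & (X *m M)^t* == X *m M].

Lemma ctrmx_mul m n p (M : 'M[C]_(m, n)) (N : 'M[C]_(n, p)) :
  (M *m N)^t* = N^t* *m M^t*.
Proof. by rewrite trmx_mul map_mxM. Qed.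

Lemma mul_ctrmx_eq0 n (u : 'rV[C]_n) : u *m u^t* = 0 -> u = 0.
Proof.
move=> /matrixP/(_ 0 0); rewrite !mxE => /eqP.
under eq_bigr do rewrite !mxE -normCK.
rewrite psumr_eq0 => [|i _]; last by rewrite exprn_ge0.
move=> /allP H; apply/rowP => i; rewrite mxE.
by have /eqP/eqP := H i (mem_index_enum i); rewrite sqrf_eq0 normr_eq0 => /eqP.
Qed.

Lemma gram_unitmx m n (B : 'M[C]_(m, n)) : row_free B -> B *m B^t* \in unitmx.
Proof.
move=> fB; rewrite -row_free_unit -kermx_eq0; apply/eqP/row_matrixP => i.
rewrite row0; set v := row i _.
have v0 : v *m (B *m B^t*) = 0 by apply/sub_kermxP/row_sub.
have : v *m B *m (v *m B)^t* = 0.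
  by rewrite ctrmx_mul !mulmxA -[v *m B *m _]mulmxA v0 mul0mx.
move/mul_ctrmx_eq0 => E; apply: (row_free_inj fB).
by rewrite E mul0mx.
Qed.

Lemma mpinv_ex m n (M : 'M[C]_(m, n)) : exists X, is_mpinv M X.
Proof.
suff fact r (c : 'M[C]_(m, r)) (b : 'M_(r, n)) : row_full c -> row_free b ->
    M = c *m b -> exists X, is_mpinv M X.
  exact: (fact _ _ _ (col_base_full M) (row_base_free M) (esym (mulmx_base M))).
move=> fc /gram_unitmx ub E.
have uc : c^t* *m c \in unitmx.
  rewrite -[X in _ *m X]trmxCK; apply: gram_unitmx.
  by rewrite /row_free mxrank_map mxrank_tr; exact: fc.
have inv_herm p (G : 'M[C]_p) : G^t* = G -> (invmx G)^t* = invmx G.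
  by move=> h; rewrite trmx_inv map_invmx h.
set G := b *m b^t* in ub; set H := c^t* *m c in uc.
have hG : (invmx G)^t* = invmx G by apply: inv_herm; rewrite ctrmx_mul trmxCK.
have hH : (invmx H)^t* = invmx H by apply: inv_herm; rewrite ctrmx_mul trmxCK.
pose X := b^t* *m invmx G *m (invmx H *m c^t*).
have MX : M *m X = c *m invmx H *m c^t*.
  by rewrite E /X !mulmxA -[c *m b *m b^t*]mulmxA mulmxK.
have XM : X *m M = b^t* *m invmx G *m b.
  by rewrite E /X !mulmxA -[_ *m c^t* *m c]mulmxA mulmxKV.
exists X; apply/and4P; split; apply/eqP.
- by rewrite MX E !mulmxA -[_ *m c^t* *m c]mulmxA mulmxKV.
- by rewrite XM /X !mulmxA -[_ *m b *m b^t*]mulmxA mulmxKV.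
- by rewrite MX !ctrmx_mul trmxCK hH mulmxA.
- by rewrite XM !ctrmx_mul trmxCK hG mulmxA.
Qed.

Definition mpinv m n (M : 'M[C]_(m, n)) : 'M[C]_(n, m) := xchoose (mpinv_ex M).

Lemma mpinvP m n (M : 'M[C]_(m, n)) : is_mpinv M (mpinv M).
Proof. exact: xchooseP. Qed.

Lemma is_mpinv_uniq m n (M : 'M[C]_(m, n)) X Y :
  is_mpinv M X -> is_mpinv M Y -> X = Y.
Proof.
move=> /and4P[/eqP X1 /eqP X2 /eqP X3 /eqP X4].
move=> /and4P[/eqP Y1 /eqP Y2 /eqP Y3 /eqP Y4].
have E1 : M *m X = M *m Y.
  transitivity ((M *m X *m (M *m Y))^t*); last by rewrite mulmxA X1.
  by rewrite ctrmx_mul X3 Y3 mulmxA Y1.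
have E2 : X *m M = Y *m M.
  transitivity ((Y *m M *m (X *m M))^t*); last by rewrite -mulmxA [M *m _]mulmxA X1.
  by rewrite ctrmx_mul X4 Y4 -mulmxA [M *m _]mulmxA Y1.
by rewrite -X2 -mulmxA E1 mulmxA E2 Y2.
Qed.

End MoorePenrose.

Section CoreEP.
Variables (C : numClosedFieldType) (n : nat).
Implicit Types M X Y : 'M[C]_n.

Definition is_core_ep M X : bool :=
  [&& X *m M *m X == X, eq_range X (X^t*) & eq_range X (M ^+ mxindex M)].

Lemma core_ep_ex M : exists X, is_core_ep M X.
Proof.
have /and3P[/eqP D1 /eqP D2 /eqP D3] := drazinP M.
rewrite /is_core_ep; set k := mxindex M in D1 *; set D := drazin M in D1 D2 D3.
have /and4P[/eqP P1 /eqP P2 /eqP P3 _] := mpinvP (M ^+ k).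
set Mk := M ^+ k in D1 P1 P2 P3 *; set P := Mk *m mpinv Mk in P1 P3.
have PP : P *m P = P by rewrite /P mulmxA P1.
have DMk : D *m M *m Mk = Mk by rewrite -mulmxA -[M *m Mk]exprS.
have MDP : M *m D *m P = P by rewrite D3 /P mulmxA DMk.
have cDk : D *m Mk = Mk *m D by apply: commrX; apply: esym.
have XMk : D *m P = Mk *m (D *m mpinv Mk) by rewrite /P !mulmxA cDk.
have XE : M *m (D *m P) = P by rewrite mulmxA MDP.
have hX : (D *m P)^t* = P *m D^t* by rewrite ctrmx_mul P3.
have rP : \rank P = \rank Mk.
  apply/eqP; rewrite eqn_leq mxrankM_maxl /=.
  by rewrite -[in X in (X <= _)%N]P1 mxrankM_maxl.
have rX : \rank (D *m P) = \rank Mk.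
  apply/eqP; rewrite eqn_leq {1}XMk mxrankM_maxl /= -rP -[in X in (X <= _)%N]XE.
  exact: mxrankM_maxr.
have R1 : eq_range (D *m P) Mk.
  rewrite /eq_range -mxrank_leqif_eq ?mxrank_tr ?rX //.
  by apply/range_subP; exists (D *m mpinv Mk).
have R2 : eq_range ((D *m P)^t*) Mk.
  rewrite /eq_range -mxrank_leqif_eq ?mxrank_tr ?mxrank_map ?mxrank_tr ?rX //.
  by apply/range_subP; exists (mpinv Mk *m D^t*); rewrite hX mulmxA.
exists (D *m P); apply/and3P; split=> //.
  by apply/eqP; rewrite -mulmxA XE -mulmxA PP.
by apply: eq_range_trans R1 _; rewrite eq_range_sym.
Qed.

Definition core_ep M : 'M[C]_n := xchoose (core_ep_ex M).

Lemma core_epP M : is_core_ep M (core_ep M).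
Proof. exact: xchooseP. Qed.

Lemma is_core_ep_uniq M X Y : is_core_ep M X -> is_core_ep M Y -> X = Y.
Proof.
move=> /and3P[/eqP X1 X2 X3] /and3P[/eqP Y1 Y2 Y3].
have XY : eq_range X Y by apply: eq_range_trans X3 _; rewrite eq_range_sym.
have /andP[/range_subP[Z EZ] _] : eq_range (X^t*) (Y^t*).
  apply: eq_range_trans Y2; apply: eq_range_trans XY.
  by rewrite eq_range_sym.
have /andP[_ /range_subP[T ET]] := XY.
have {EZ} EZ : X = Z^t* *m Y by rewrite -[X]trmxCK EZ ctrmx_mul trmxCK.
transitivity (X *m M *m Y); last by rewrite ET mulmxA X1.
by rewrite EZ -!mulmxA [Y *m _]mulmxA Y1.
Qed.

End CoreEP.

Section Weighted.
Variables (C : numClosedFieldType) (q n : nat) (W : 'M[C]_(n, q)).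
Implicit Types A X Y : 'M[C]_(q, n).

Definition wprod X Y : 'M[C]_(q, n) := X *m W *m Y.

(* The W-product has no unit in general: the power is meaningful for [0 < l]
   only, and the value for [l = 0] is an arbitrary default. *)
Definition wpower X (l : nat) : 'M[C]_(q, n) := iterop l wprod X 0.

Lemma wpower1 X : wpower X 1 = X.
Proof. by []. Qed.

Lemma wpowerS X l : (0 < l)%N -> wpower X l.+1 = wprod X (wpower X l).
Proof. by case: l. Qed.

Definition wdrazin A : 'M[C]_(q, n) := A *m drazin (W *m A) ^+ 2.

Definition wcore_ep A : 'M[C]_(q, n) := A *m core_ep (W *m A) ^+ 2.

Definition wweak_group m A : 'M[C]_(q, n) :=
  wpower (wcore_ep A) m.+1 *m W *m wpower A m.

End Weighted.

(* Main.v *)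
(** With B = WA, the first equation says X = B B^D X, and B B^D fixes the range
    of B^Ind(B), hence every product B B^cEP Y; the candidate X0 is of that form.
    Conversely, if AX = AX0 then X = B^D W(AX) = B^D W(A X0) = X0. *)
Require Import Defs.
From mathcomp Require Import all_boot all_order all_algebra.
From mathcomp Require Import reals complex.
Local Open Scope ring_scope.

Lemma mulmx_drazinC (F : fieldType) n (M : 'M[F]_n) :
  M *m drazin M = drazin M *m M.
Proof. by have /and3P[_ _ /eqP] := drazinP M. Qed.

(** The columns of [core_ep M] lie in the range of [M ^+ k], with [k] the index of [M], and
    [drazin M *m M] fixes that range. *)
Lemma drazin_mulmx_core_ep (C : numClosedFieldType) n (M : 'M[C]_n) :
  drazin M *m M *m core_ep M = core_ep M.
Proof.
have /and3P[/eqP DM _ _] := drazinP M.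
have /and3P[_ _ /andP[/range_subP[Z ->] _]] := core_epP M.
by rewrite mulmxA -(mulmxA (drazin M)) -[M *m _]GRing.exprS DM.
Qed.

(** With B = WA and D its Drazin inverse, the left side is B D D B; commuting B with D and using D B
    D = D leaves the projector D B. *)
Lemma mulmx_wdrazin (C : numClosedFieldType) q n (W : 'M[C]_(n, q))
    (A : 'M[C]_(q, n)) :
  W *m wdrazin W A *m W *m A = drazin (W *m A) *m (W *m A).
Proof.
have /and3P[_ /eqP DMD _] := drazinP (W *m A).
rewrite /wdrazin GRing.expr2 -(mulmxA _ W A) (mulmxA W A) (mulmxA (W *m A)).
by rewrite mulmx_drazinC DMD.
Qed.

(** Peeling one factor off the (m+1)-fold W-product exposes the leading B B^cEP; [Y] collects all
    the rest. *)
Lemma mulmx_wweak_group (C : numClosedFieldType) q n (W : 'M[C]_(n, q))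
    (A : 'M[C]_(q, n)) m : (0 < m)%N ->
  exists Y, W *m wweak_group W m A = W *m A *m core_ep (W *m A) *m Y.
Proof.
move=> m_gt0; rewrite /wweak_group wpowerS // /wprod.
rewrite {1}/wcore_ep GRing.expr2 -!mulmxA mulmxA.
by eexists; rewrite -!mulmxA.
Qed.

Lemma wweak_group_system_uniq (C : numClosedFieldType) q n (W : 'M[C]_(n, q))
    (A : 'M[C]_(q, n)) m (X : 'M[C]_(n, q)) : (0 < m)%N ->
  (X = W *m wdrazin W A *m W *m A *m X /\
   A *m X = A *m W *m wweak_group W m A *m W *m A *m mpinv A)
  <-> X = W *m wweak_group W m A *m W *m A *m mpinv A.
Proof.
move=> m_gt0; rewrite mulmx_wdrazin.
have [Y] := mulmx_wweak_group _ _ _ W A _ m_gt0.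
rewrite -(mulmxA A W); set G := W *m wweak_group W m A => EG.
have fixG : drazin (W *m A) *m (W *m A) *m G = G.
  rewrite EG !(mulmxA _ _ Y); congr (_ *m Y).
  (* The projector D B commutes with B, so it moves past the leading B and reaches [core_ep]. *)
  rewrite [_ *m (W *m A *m _)]mulmxA -mulmx_drazinC -!(mulmxA (W *m A)).
  by rewrite drazin_mulmx_core_ep.
(* Regrouped, the second equation reads A X = A X0, which [X0] satisfies trivially. *)
rewrite -!(mulmxA A); set X0 := G *m W *m A *m mpinv A.
have fixX0 : drazin (W *m A) *m (W *m A) *m X0 = X0.
  by rewrite /X0 -!(mulmxA G) (mulmxA _ G) fixG.
split=> [[EX AX]|->]; last by rewrite fixX0.
by rewrite EX -fixX0 -!mulmxA AX.
Qed.

Theorem theorem3p1 (R : realType) (q n m : nat)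
    (A : 'M[R[i]]_(q, n)) (W : 'M[R[i]]_(n, q))
    (W_neq0 : W != 0) (m_gt0 : (0 < m)%N) :
  forall X : 'M[R[i]]_(n, q),
  (X = W *m wdrazin W A *m W *m A *m X /\
   A *m X = A *m W *m wweak_group W m A *m W *m A *m mpinv A)
  <-> X = W *m wweak_group W m A *m W *m A *m mpinv A.
Proof. by move=> X; apply: wweak_group_system_uniq. Qed.
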